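(* Let $f:\mathbb{R}^{m\times n}\to\mathbb{R}$ be twice differentiable and let $g(A,B)=f(AB^\top)$ for $(A,B)\in\mathbb{R}^{m\times r}\times\mathbb{R}^{n\times r}$. Assume that $f$ satisfies $\alpha$-RSC, with $\alpha>0$, over a subset $\mathcal{X}\subseteq\mathbb{R}^{m\times n}_{\mathrm{rank}(r)}$. Assume that $\widehat X$ is a global minimizer, i.e. $\mathrm{rank}(\widehat X)\le r$ and $f(\widehat X)=\min_{\mathrm{rank}(X)\le r}f(X)$, that $\widehat X\in\mathcal{X}$, and that $\widehat X$ satisfies $$\text{either } \mathrm{rank}(\widehat X)<r,\ \text{ or }\ \mathrm{rank}(\widehat X)=r\ \text{ and }\ \|\nabla f(\widehat X)\|<\alpha\,\sigma_r(\widehat X).$$ Let $$\mathcal{N}=\Big\{X\in\mathcal{X}:\ \mathrm{rank}(X)<r\ \text{ or }\ \tfrac{\|\nabla f(X)\|}{\sigma_r(X)}<2\alpha\Big\}$$ in the case that $\mathrm{rank}(\widehat X)<r$, or $$\mathcal{N}=\Big\{X\in\mathcal{X}:\ \mathrm{rank}(X)<r\ \text{ or }\ \tfrac{\|\nabla f(\widehat X)\|}{\sigma_r(\widehat X)}+\tfrac{\|\nabla f(X)\|}{\sigma_r(X)}<2\alpha\Big\}$$ in the case that $\mathrm{rank}(\widehat X)=r$. Then: (1) For any fixed point $X$ of projected gradient descent (PGD) on $\min_{\mathrm{rank}(X)\le r}f(X)$ with any step size $\eta>0$, if $X\in\mathcal{N}$, then $X=\widehat X$. (2) If $X=AB^\top\in\mathcal{N}$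 where $(A,B)$ is a second-order stationary point (SOSP) of $g$, then $X=\widehat X$.
   Context: Let $m,n,r$ be positive integers with $r\le\min\{m,n\}$. $\|\cdot\|$ is the spectral norm, $\|\cdot\|_F$ the Frobenius norm, $\langle\cdot,\cdot\rangle$ the trace inner product, $\sigma_r(X)$ the $r$-th largest singular value. $\mathbb{R}^{m\times n}_{\mathrm{rank}(r)}$ denotes the set of $m\times n$ matrices of rank $\le r$. $f$ satisfies $\alpha$-RSC (restricted strong convexity) over $\mathcal{X}$ if $f(Y)\ge f(X)+\langle\nabla f(X),Y-X\rangle+\frac\alpha2\|X-Y\|_F^2$ for all $X,Y\in\mathcal{X}$. $X$ is a fixed point of PGD at step size $\eta>0$ if $X\in\arg\min_{\mathrm{rank}(X')\le r}\|X'-(X-\eta\nabla f(X))\|_F$. (PGD iterates $X\leftarrow\mathcal{P}_r(X-\eta\nabla f(X))$ with $\mathcal{P}_r$ the possibly non-unique Frobenius projection onto matrices of rank $\le r$.) $(A,B)$ is a SOSP of $g$ if $\nabla g(A,B)=0$ and $\nabla^2g(A,B)\succeq0$. *)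

(* Defs.v *)
(* MathComp / MathComp-Analysis; rootsR comes from mathcomp-real-closed. *)
From HB Require Import structures.
From mathcomp Require Import all_boot all_order all_algebra.
From mathcomp Require Import all_classical all_reals all_analysis.
From mathcomp Require Import polyrcf.

Set Implicit Arguments.
Unset Strict Implicit.
Unset Printing Implicit Defensive.

Import Order.TTheory GRing.Theory Num.Theory.
Import numFieldNormedType.Exports.

Local Open Scope classical_set_scope.
Local Open Scope ring_scope.

Section MatrixNorms.
Variable R : realType.

Definition inner m n (X Y : 'M[R]_(m, n)) : R := \tr (X^T *m Y).

(* On column vectors ('cV[R]_n = 'M[R]_(n, 1)) this is the Euclidean norm. *)
Definition frob m n (X : 'M[R]_(m, n)) : R := Num.sqrt (inner X X).

(* The operator norm induced by the Euclidean norms; the set is bounded and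
   contains 0, so that [sup] is its least upper bound. *)
Definition spec_norm m n (X : 'M[R]_(m, n)) : R :=
  sup [set frob (X *m v) | v in [set v : 'cV[R]_n | frob v <= 1]].

(* The real roots of the characteristic polynomial in nonincreasing order,
   each repeated according to its multiplicity. For a symmetric matrix these
   are all n eigenvalues. *)
Definition eigenvalues n (S : 'M[R]_n) : seq R :=
  flatten [seq nseq (mup a (char_poly S)) a | a <- rev (rootsR (char_poly S))].

(* The k-th largest singular value, for k counted from 1. *)
Definition sigma m n (k : nat) (X : 'M[R]_(m, n)) : R :=
  Num.sqrt (nth 0 (eigenvalues (X^T *m X)) k.-1).

End MatrixNorms.

Section Calculus.
Variable R : realType.

(* The gradient for the trace inner product: the matrix of partial
   derivatives. *)
Definition grad m n (f : 'M[R]_(m, n) -> R) (X : 'M[R]_(m, n)) : 'M[R]_(m, n) :=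
  \matrix_(i, j) 'D_(delta_mx i j) f X.

Definition twice_differentiable m n (f : 'M[R]_(m, n) -> R) : Prop :=
  (forall X, differentiable f X) /\ (forall X, differentiable (grad f) X).

Definition grad_pair m n r (g : 'M[R]_(m, r) * 'M[R]_(n, r) -> R)
    (p : 'M[R]_(m, r) * 'M[R]_(n, r)) : 'M[R]_(m, r) * 'M[R]_(n, r) :=
  (grad (fun A => g (A, p.2)) p.1, grad (fun B => g (p.1, B)) p.2).

Definition inner_pair m n r (p q : 'M[R]_(m, r) * 'M[R]_(n, r)) : R :=
  inner p.1 q.1 + inner p.2 q.2.

(* The Hessian of g at p is the differential of the gradient of g at p. *)
Definition sosp m n r (g : 'M[R]_(m, r) * 'M[R]_(n, r) -> R)
    (p : 'M[R]_(m, r) * 'M[R]_(n, r)) : Prop :=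
  grad_pair g p = 0 /\ forall h, 0 <= inner_pair h ('d (grad_pair g) p h).

End Calculus.

Section LowRank.
Variable R : realType.
Variables m n : nat.
Implicit Types (f : 'M[R]_(m, n) -> R) (X Y : 'M[R]_(m, n)).

Definition factored r f (p : 'M[R]_(m, r) * 'M[R]_(n, r)) : R :=
  f (p.1 *m p.2^T).

Definition rsc (alpha : R) (XX : set 'M[R]_(m, n)) f : Prop :=
  forall X Y, XX X -> XX Y ->
    f X + inner (grad f X) (Y - X) + alpha / 2 * frob (X - Y) ^+ 2 <= f Y.

Definition rank_global_min (r : nat) f X : Prop :=
  (\rank X <= r)%N /\ forall Y, (\rank Y <= r)%N -> f X <= f Y.

(* The possibly non-unique Frobenius projections onto the matrices of rank at
   most r. *)
Definition rank_proj (r : nat) Y : set 'M[R]_(m, n) :=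
  [set X | (\rank X <= r)%N /\
           forall X', (\rank X' <= r)%N -> frob (X - Y) <= frob (X' - Y)].

Definition pgd_fixed (r : nat) f (eta : R) X : Prop :=
  rank_proj r (X - eta *: grad f X) X.

(* The quotients by sigma r are only relevant at matrices of rank r, where
   sigma r is positive. *)
Definition uniq_region (r : nat) f (alpha : R) (XX : set 'M[R]_(m, n)) Xhat :
    set 'M[R]_(m, n) :=
  if (\rank Xhat < r)%N then
    [set X | XX X /\
       ((\rank X < r)%N \/ spec_norm (grad f X) / sigma r X < 2 * alpha)]
  else
    [set X | XX X /\
       ((\rank X < r)%N \/
        spec_norm (grad f Xhat) / sigma r Xhat
          + spec_norm (grad f X) / sigma r X < 2 * alpha)].

End LowRank.

(* Main.v *)
(* At a stationary point X of rank r both G X^T and X^T G vanish, where G is the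
   gradient of f at X, with spectral norm |G|; at smaller rank even G = 0. Then X is a best
   approximation of rank at most r of X + (sigma_r(X) / |G|) G (Eckart-Young:
   the singular values of the second summand are at most sigma_r(X) and its row
   and column spaces are orthogonal to those of X); expanding the squares,
     - <G, Y - X> <= |G| / (2 sigma_r(X)) |Y - X|_F^2   when rank Y <= r.
   Adding the two restricted strong convexity inequalities for X and Xhat and
   bounding both gradient terms in this way leaves
     (2 alpha - k(X) - k(Xhat)) |X - Xhat|_F^2 <= 0,
   with k = |G| / sigma_r at rank r and k = 0 at smaller rank. *)
Require Import Defs.
From HB Require Import structures.
From mathcomp Require Import all_boot all_order all_algebra.
From mathcomp Require Import all_classical all_reals all_analysis.
From mathcomp Require Import polyrcf complex ring lra zify.

Set Implicit Arguments.
Unset Strict Implicit.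
Unset Printing Implicit Defensive.

Import Order.TTheory GRing.Theory Num.Theory.
Import numFieldNormedType.Exports.

Local Open Scope classical_set_scope.
Local Open Scope ring_scope.

(** * Spectral decomposition of Gram matrices *)

(** The matrix is a sum of rank-one matrices, one for each nonzero entry, and rank is
    subadditive. *)
Lemma mxrank_diag_le (F : fieldType) n (d : 'rV[F]_n) :
  (\rank (diag_mx d) <= #|[pred i | d 0%R i != 0%R]|)%N.
Proof.
have -> : diag_mx d = \sum_(i | d 0 i != 0) d 0 i *: delta_mx i i.
  apply/matrixP => i j; rewrite summxE !mxE.
  rewrite big_mkcond (bigD1 j) //= big1 ?addr0 => [|k kj].
    have [dj0|_] := eqVneq (d 0 j) 0.
      by case: eqVneq => [->|]; rewrite ?dj0 ?mulr0n ?mul0rn.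
    by rewrite !mxE eqxx andbT mulr_natr; case: eqVneq => [->|].
  by rewrite !mxE [j == k]eq_sym (negPf kj) andbF mulr0 if_same.
rewrite -sum1_card.
apply: (big_ind2 (fun (A : 'M[F]_n) k => (\rank A <= k)%N))
  => [|A a B b Aa Bb|i _].
- by rewrite mxrank0.
- by rewrite (leq_trans (mxrank_add _ _)) ?leq_add.
- by rewrite (leq_trans (mxrank_scale _ _)) // mxrank_delta.
Qed.

Lemma mxrank_diag (F : fieldType) n (d : 'rV[F]_n) :
  \rank (diag_mx d) = #|[pred i | d 0%R i != 0%R]|.
Proof.
apply/eqP; rewrite eqn_leq mxrank_diag_le /=.
(* The sum of diag d and the 0-1 diagonal of the zeros of d is invertible. *)
pose e : 'rV[F]_n := \row_i (d 0 i == 0)%:R.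
have u : diag_mx d + diag_mx e \in unitmx.
  rewrite -raddfD /= unitmxE det_diag unitfE prodf_seq_neq0.
  apply/allP => i _ /=; rewrite !mxE.
  by have [->|] := eqVneq (d 0 i) 0; rewrite ?add0r ?oner_eq0 ?addr0.
have := mxrank_add (diag_mx d) (diag_mx e); rewrite mxrank_unit // => le_n.
have := leq_trans le_n (leq_add (leqnn _) (mxrank_diag_le e)).
rewrite -[X in (X <= _)%N -> _]card_ord -(cardC [pred i | d 0 i != 0]).
rewrite (@eq_card _ [pred i | e 0 i != 0] [predC [pred i | d 0 i != 0]]).
  by rewrite leq_add2r.
move=> i; rewrite !inE mxE negbK.
by have [_|_] := eqVneq (d 0 i) 0; rewrite ?oner_eq0 ?eqxx.
Qed.

Lemma char_poly_conj (F : comNzRingType) n (P Q A : 'M[F]_n) :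
  Q *m P = 1%:M -> char_poly (P *m A *m Q) = char_poly A.
Proof.
move=> QP; have PQ := mulmx1C QP; rewrite /char_poly /char_poly_mx !map_mxM.
have -> : 'X%:M - map_mx polyC P *m map_mx polyC A *m map_mx polyC Q =
    map_mx polyC P *m ('X%:M - map_mx polyC A) *m map_mx polyC Q.
  rewrite mulmxBr mulmxBl scalar_mxC -[in X in _ = X - _]mulmxA.
  by rewrite -[X in _ = _ *m X - _]map_mxM PQ map_mx1 mulmx1.
by rewrite !det_mulmx mulrAC -det_mulmx -map_mxM PQ map_mx1 det1 mul1r.
Qed.

Section Inner.
Variable R : realType.

Lemma innerE m n (X Y : 'M[R]_(m, n)) : inner X Y = \sum_j \sum_i X i j * Y i j.
Proof.
rewrite /inner /mxtrace; apply: eq_bigr => j _; rewrite mxE.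
by apply: eq_bigr => i _; rewrite mxE.
Qed.

Lemma inner_ge0 m n (X : 'M[R]_(m, n)) : 0 <= inner X X.
Proof.
rewrite innerE sumr_ge0 // => j _; rewrite sumr_ge0 // => i _.
by rewrite -expr2 sqr_ge0.
Qed.

Lemma inner_eq0 m n (X : 'M[R]_(m, n)) : inner X X = 0 -> X = 0.
Proof.
rewrite innerE => X0; apply/matrixP => i j; rewrite mxE.
move/eqP: X0; rewrite psumr_eq0 => [|k _]; last first.
  by rewrite sumr_ge0 // => l _; rewrite -expr2 sqr_ge0.
move=> /allP/(_ j (mem_index_enum _))/=; rewrite psumr_eq0 => [|k _]; last first.
  by rewrite -expr2 sqr_ge0.
by move=> /allP/(_ i (mem_index_enum _))/=; rewrite -expr2 sqrf_eq0 => /eqP.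
Qed.

Lemma mulmx_gram_eq0 k m n (A : 'M[R]_(k, m)) (X : 'M[R]_(m, n)) :
  A *m X *m X^T = 0 -> A *m X = 0.
Proof.
move=> AXX; apply: trmx_inj; rewrite trmx0; apply: inner_eq0.
by rewrite /inner trmxK trmx_mul mulmxA AXX mul0mx mxtrace0.
Qed.

(** Over the reals [X *m X^T] and [X] have the same left kernel, since [A X X^T = 0] makes the
    squared norm of [A X] vanish. *)
Lemma mxrank_gram m n (X : 'M[R]_(m, n)) : \rank (X *m X^T) = \rank X.
Proof.
apply/eqP; rewrite eqn_leq mxrankM_maxl /=.
have : (kermx (X *m X^T) <= kermx X)%MS.
  by apply/sub_kermxP/mulmx_gram_eq0; rewrite -mulmxA mulmx_ker.
move/mxrankS; rewrite !mxrank_ker.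
have := rank_leq_row X; have := rank_leq_row (X *m X^T); lia.
Qed.

End Inner.

Section Gram.
Variable R : realType.
Local Open Scope sesquilinear_scope.
Local Notation C := (R[i]).
Local Notation toC := (real_complex R).

Lemma map_toC_conj m n (X : 'M[R]_(m, n)) : (map_mx toC X)^t* = map_mx toC X^T.
Proof.
apply/matrixP=> i j; rewrite !mxE; apply/CrealP/complex_realP.
by exists (X j i).
Qed.

(** Parseval for orthogonal columns. It serves twice: for [X P^*], whose squared column norms are
    the eigenvalues, and for [P^*], whose columns are orthonormal. *)
Lemma gram_diag_conj m n (Y : 'M[C]_(m, n)) (w : 'cV[C]_n) (D : 'rV_n) :
  Y^t* *m Y = diag_mx D ->
  ((Y *m w)^t* *m (Y *m w)) 0 0 = \sum_i D 0 i * `|w i 0| ^+ 2.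
Proof.
move=> YD; rewrite trmx_mul map_mxM mulmxA -[_ *m _ *m Y]mulmxA YD mxE.
apply: eq_bigr => i _; rewrite mul_mx_diag !mxE normCK; ring.
Qed.

Lemma gram_spectral m n (X : 'M[R]_(m, n)) : exists d : 'rV[R]_n,
  [/\ forall i, 0 <= d 0 i,
      char_poly (X^T *m X) = \prod_i ('X - (d 0 i)%:P),
      #|[pred i | d 0 i != 0]| = \rank X &
      forall c, (forall i, d 0 i != 0 -> c <= d 0 i) -> forall w : 'cV_m,
        c * inner (X^T *m w) (X^T *m w)
          <= inner (X *m (X^T *m w)) (X *m (X^T *m w))].
Proof.
(* For S = P^* D P over the complex numbers, the columns of Y = X P^* are
   orthogonal with squared norms D, hence D >= 0. *)
pose Xc := map_mx toC X; pose S := Xc^T *m Xc.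
have XcT : Xc^t* = Xc^T by rewrite map_toC_conj map_trmx.
have StE : S^t* = S by rewrite trmx_mul map_mxM XcT -XcT trmxCK XcT.
have Sherm : S \is hermsymmx.
  by apply/is_hermitianmxP; rewrite expr0 scale1r StE.
pose P := spectralmx S; pose D := spectral_diag S.
have PU : P \is unitarymx := spectral_unitarymx S.
have PPt : P *m P^t* = 1%:M by apply/unitarymxP.
have PtP : P^t* *m P = 1%:M by exact: mulmx1C.
have SE : S = P^t* *m diag_mx D *m P.
  by rewrite -invmx_unitary //; apply/orthomx_spectralP/hermitian_normalmx.
pose Y := Xc *m P^t*.
have YtE : Y^t* = P *m Xc^T by rewrite trmx_mul map_mxM trmxCK XcT.
have YY : Y^t* *m Y = diag_mx D.
  rewrite YtE /Y mulmxA -[P *m _ *m Xc]mulmxA -/S SE !mulmxA PPt mul1mx.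
  by rewrite -mulmxA PPt mulmx1.
have DE i : D 0 i = \sum_k `|Y k i| ^+ 2.
  have := congr1 (fun M : 'M[C]_n => M i i) YY; rewrite !mxE eqxx mulr1n => <-.
  by apply: eq_bigr => k _; rewrite !mxE normCK mulrC.
have D_ge0 i : 0 <= D 0 i by rewrite DE sumr_ge0 // => k _; rewrite exprn_ge0.
(* Nonnegative elements of [R[i]] are real, so taking real parts loses nothing. *)
pose d := \row_i complex.Re (D 0 i).
have dE i : (d 0 i)%:C%C = D 0 i by rewrite mxE RRe_real // ger0_real.
have dmap : map_mx toC d = D by apply/rowP => i; rewrite -dE !mxE.
exists d; split.
- by move=> i; rewrite -ler0c dE.
- apply: (map_poly_inj (real_complex R)); rewrite map_char_poly rmorph_prod /=.
  rewrite map_mxM -map_trmx -/Xc -/S SE char_poly_conj //.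
  rewrite char_poly_trig ?diag_mx_is_trig //; apply: eq_bigr => i _.
  by rewrite rmorphB /= map_polyX map_polyC /= dE mxE eqxx mulr1n.
- rewrite -mxrank_diag; have := mxrank_gram X^T; rewrite trmxK mxrank_tr => <-.
  rewrite -[LHS](mxrank_map toC) -[RHS](mxrank_map toC) map_diag_mx dmap.
  rewrite map_mxM -map_trmx -/Xc -/S SE mxrankMfree; last first.
    by rewrite row_free_unit unitarymx_unit.
  have [PtU _] := mulmx1_unit PtP.
  by rewrite -[RHS]mxrank_tr trmx_mul mxrankMfree ?mxrank_tr //
    row_free_unit unitmx_tr.
(* In the eigenbasis both sides are sums of [|v_i|^2], weighted by [c] and by [D_i]. A vector in the
   range of [X^T] has no component where [D_i = 0], so a lower bound on the nonzero eigenvalues is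
   enough. *)
- move=> c cd w; pose wc := map_mx toC w.
  pose u := Xc^T *m wc; pose v := P *m u.
  have v0 i : D 0 i = 0 -> v i 0 = 0.
    move=> Di; rewrite /v /u mulmxA -YtE mxE big1 // => k _.
    suff: Y k i = 0 by rewrite !mxE => ->; rewrite conjC0 mul0r.
    move/eqP: Di; rewrite DE psumr_eq0 => [|l _]; last by rewrite exprn_ge0.
    move/allP/(_ k (mem_index_enum _)) => /=.
    by rewrite expf_eq0 /= normr_eq0 => /eqP.
  have innerC k (z : 'cV[R]_k) : (inner z z)%:C%C =
      ((map_mx toC z)^t* *m map_mx toC z) 0 0.
    by rewrite map_toC_conj -map_mxM [in RHS]mxE /inner /mxtrace big_ord1.
  have uw : map_mx toC (X^T *m w) = u by rewrite map_mxM -map_trmx.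
  have Xuw : map_mx toC (X *m (X^T *m w)) = Xc *m u by rewrite map_mxM uw.
  rewrite -lecR rmorphM /= !innerC uw Xuw.
  have uE : u = P^t* *m v by rewrite mulmxA PtP mul1mx.
  have -> : Xc *m u = Y *m v by rewrite uE mulmxA.
  rewrite (gram_diag_conj _ YY).
  have PP1 : (P^t*)^t* *m P^t* = diag_mx (const_mx 1).
    by rewrite trmxCK PPt diag_const_mx.
  rewrite uE (gram_diag_conj _ PP1) mulr_sumr; apply: ler_sum => i _.
  rewrite mxE mul1r.
  have [d0|d0] := eqVneq (d 0 i) 0.
    by rewrite v0 ?normr0 ?expr0n ?mulr0 // -dE d0.
  by rewrite ler_wpM2r ?exprn_ge0 // -dE lecR cd.
Qed.
End Gram.

(** * Singular values *)

Lemma gt_trans (R : realDomainType) : transitive (>%R : rel R).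
Proof. by move=> ? ? ? /[swap]; exact: lt_trans. Qed.

(** The positive entries of a nonincreasing list form a prefix. The default 0 is not positive, so
    the equality also holds past the end. *)
Lemma nth_gt0_sorted (R : realDomainType) (t : seq R) k :
  sorted >=%R t -> (0 < nth 0 t k) = (k < count (> 0%R) t)%N.
Proof.
elim: t k => [|a t IHt] k at_; first by rewrite nth_nil ltxx ltn0.
have t_sorted := path_sorted at_.
have le_a : all (<= a) t := order_path_min ge_trans at_.
have [a_gt0|a_le0] := ltP 0 a; case: k => [|k] /=; rewrite ?a_gt0 ?IHt //.
all: have /eqP c0 : count (> 0) t == 0%N by
  rewrite -leqn0 leqNgt -has_count -all_predC; apply: sub_all le_a => x xa /=;
  rewrite -leNgt (le_trans xa).
- by rewrite ltNge a_le0 c0.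
- by rewrite ltNge a_le0 c0.
Qed.

Section Sigma.
Variable R : realType.

Lemma sorted_flatten_nseq (s : seq R) (k : R -> nat) :
  sorted >%R s -> sorted >=%R (flatten [seq nseq (k a) a | a <- s]).
Proof.
rewrite !sorted_pairwise; [|exact: ge_trans|exact: gt_trans].
elim: s => //= a s IHs /andP[/allP a_gt s_sorted].
rewrite pairwise_cat IHs // andbT; apply/andP; split.
  apply/allrelP => x y /nseqP[-> _] /flatten_mapP[b bs /nseqP[-> _]].
  exact/ltW/a_gt.
by elim: (k a) => //= l ->; rewrite andbT; apply/allP => x /nseqP[-> _] /=.
Qed.

(** Two sorted lists agree once every [x] occurs equally often in both: here, as often as its
    multiplicity as a root of the characteristic polynomial. *)
Lemma eigenvalues_prod_XsubC n (S : 'M[R]_n) (s : seq R) :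
  char_poly S = \prod_(a <- s) ('X - a%:P) -> eigenvalues S = sort >=%R s.
Proof.
move=> charS.
have roots_sorted : sorted >%R (rev (rootsR (char_poly S))).
  by rewrite rev_sorted; exact: sorted_roots.
apply: (sorted_eq ge_trans ge_anti).
- exact: sorted_flatten_nseq.
- exact: sort_sorted ge_total _.
rewrite perm_sym perm_sort perm_sym; apply/allP => x _ /=; apply/eqP.
have gt_irr : irreflexive (>%R : rel R) by move=> y; exact: ltxx.
have roots_uniq := sorted_uniq (@gt_trans R) gt_irr roots_sorted.
rewrite -[RHS]mu_prod_XsubC -charS count_flatten -map_comp sumnE big_map.
under eq_bigr do rewrite /= count_nseq /=.
have char_neq0 : char_poly S != 0 by rewrite monic_neq0 ?char_poly_monic.
have [x_root|x_root] := boolP (x \in rev (rootsR (char_poly S))).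
  rewrite (bigD1_seq x) //= eqxx mul1n big1 ?addn0 // => y /negPf xy.
  by rewrite xy mul0n.
rewrite big_seq big1 => [|y y_root]; last first.
  by case: eqP => [yx|]; rewrite ?mul0n // yx (negPf x_root) in y_root.
rewrite mupNroot //; apply: contra x_root; rewrite mem_rev.
by rewrite -roots_on_rootsR // inE /= in_itv.
Qed.

(** Exactly [\rank X] eigenvalues of [X^T X] are positive, so index [(\rank X).-1] of the sorted
    list holds the smallest nonzero one, which serves as the constant [c] of [gram_spectral]. *)
Lemma sigma_rank m n (X : 'M[R]_(m, n)) :
  (0 < \rank X)%N -> 0 < sigma (\rank X) X /\
  forall w : 'cV_m, sigma (\rank X) X ^+ 2 * inner (X^T *m w) (X^T *m w)
          <= inner (X *m (X^T *m w)) (X *m (X^T *m w)).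
Proof.
move=> r_gt0; have [d [d_ge0 charS rankX Xle]] := gram_spectral X.
pose s := [seq d 0 i | i <- index_enum 'I_n].
have sE : eigenvalues (X^T *m X) = sort >=%R s.
  by apply: eigenvalues_prod_XsubC; rewrite charS big_map.
have s_sorted : sorted >=%R (sort >=%R s).
  exact: sort_sorted ge_total _.
have count_s : count (> 0) (sort >=%R s) = \rank X.
  rewrite count_sort count_map -rankX cardE size_filter.
  apply: eq_count => i /=.
  by rewrite inE lt_def d_ge0 andbT.
have nth_gt0 : 0 < nth 0 (sort >=%R s) (\rank X).-1.
  by rewrite nth_gt0_sorted // count_s prednK.
split; first by rewrite /sigma sE sqrtr_gt0.
move=> w; rewrite /sigma sE sqr_sqrtr ?(ltW nth_gt0) //; apply: Xle => i di.
have di_in : d 0 i \in sort >=%R s by rewrite mem_sort map_f ?mem_index_enum.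
(* A nonzero eigenvalue is positive, so it occurs among the first [\rank X] entries and is at least
   the last of these. *)
have di_lt : (index (d 0%R i) (sort >=%R s) < count (> 0%R) (sort >=%R s))%N.
  by rewrite -nth_gt0_sorted // nth_index // lt_def di d_ge0.
rewrite -(nth_index 0 di_in); rewrite count_s in di_lt.
apply: (sorted_leq_nth ge_trans (@lexx _ R) 0 s_sorted).
- by rewrite inE index_mem.
- by rewrite inE (leq_trans _ (count_size (> 0) _)) // count_s prednK.
- by rewrite -ltnS prednK.
Qed.

End Sigma.

(** * The trace inner product and low-rank approximation *)

Section InnerTheory.
Variable R : realType.

Lemma innerC m n (X Y : 'M[R]_(m, n)) : inner X Y = inner Y X.
Proof. by rewrite /inner -mxtrace_tr trmx_mul trmxK. Qed.

Lemma innerDr m n (X Y Z : 'M[R]_(m, n)) :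
  inner X (Y + Z) = inner X Y + inner X Z.
Proof. by rewrite /inner mulmxDr mxtraceD. Qed.

Lemma innerZr m n a (X Y : 'M[R]_(m, n)) : inner X (a *: Y) = a * inner X Y.
Proof. by rewrite /inner -scalemxAr mxtraceZ. Qed.

Lemma innerDl m n (X Y Z : 'M[R]_(m, n)) :
  inner (Y + Z) X = inner Y X + inner Z X.
Proof. by rewrite innerC innerDr !(innerC X). Qed.

Lemma innerZl m n a (X Y : 'M[R]_(m, n)) : inner (a *: X) Y = a * inner X Y.
Proof. by rewrite innerC innerZr innerC. Qed.

Lemma innerNr m n (X Y : 'M[R]_(m, n)) : inner X (- Y) = - inner X Y.
Proof. by rewrite -scaleN1r innerZr mulN1r. Qed.

Lemma innerNl m n (X Y : 'M[R]_(m, n)) : inner (- X) Y = - inner X Y.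
Proof. by rewrite innerC innerNr innerC. Qed.

Definition inner_bilinear :=
  (innerDl, innerDr, innerZl, innerZr, innerNl, innerNr).

Lemma inner_mulmxl m n p (A : 'M[R]_(m, n)) B (C : 'M[R]_(m, p)) :
  inner (A *m B) C = inner B (A^T *m C).
Proof. by rewrite /inner trmx_mul mulmxA. Qed.

Lemma inner_mulmxr m n p (A : 'M[R]_(m, n)) (B : 'M[R]_(n, p)) C :
  inner (A *m B) C = inner A (C *m B^T).
Proof. by rewrite /inner trmx_mul -mulmxA mxtrace_mulC mulmxA. Qed.

Lemma inner_cols m n (X Y : 'M[R]_(m, n)) :
  inner X Y = \sum_j inner (col j X) (col j Y).
Proof.
rewrite innerE; apply: eq_bigr => j _; rewrite innerE big_ord1.
by apply: eq_bigr => i _; rewrite !mxE.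
Qed.

Lemma inner_trmx m n (X Y : 'M[R]_(m, n)) : inner X^T Y^T = inner X Y.
Proof. by rewrite /inner trmxK mxtrace_mulC -mxtrace_tr trmx_mul trmxK. Qed.

Lemma inner_delta m n (G : 'M[R]_(m, n)) i j : inner G (delta_mx i j) = G i j.
Proof.
rewrite innerE (bigD1 j) //= (bigD1 i) //= !mxE !eqxx mulr1.
rewrite !big1 ?addr0 // => [j' /negPf jj'|i' /negPf ii'].
  by rewrite big1 // => i' _; rewrite mxE jj' andbF mulr0.
by rewrite mxE ii' mulr0.
Qed.

Lemma Cauchy_Schwarz_inner m n (X Y : 'M[R]_(m, n)) :
  inner X Y ^+ 2 <= inner X X * inner Y Y.
Proof.
have [Y0|Y_gt0] := eqVneq (inner Y Y) 0.
  rewrite (inner_eq0 Y0) {1}/inner mulmx0 mxtrace0 expr0n.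
  by rewrite mulr_ge0 ?inner_ge0.
have := inner_ge0 (inner Y Y *: X - inner X Y *: Y).
rewrite !inner_bilinear (innerC Y X).
rewrite [leRHS](_ : _ =
  inner Y Y * (inner X X * inner Y Y - inner X Y ^+ 2)); last by ring.
by rewrite pmulr_rge0 ?subr_ge0 // lt_def Y_gt0 inner_ge0.
Qed.

(** Each entry of [A *m B] pairs a row of [A] with a column of [B]; apply Cauchy-Schwarz to each and
    sum. *)
Lemma inner_mulmx_le m n p (A : 'M[R]_(m, n)) (B : 'M[R]_(n, p)) :
  inner (A *m B) (A *m B) <= inner A A * inner B B.
Proof.
rewrite -(inner_trmx (A *m B)) inner_cols.
rewrite -(inner_trmx A) [inner A^T _]inner_cols.
rewrite mulr_suml; apply: ler_sum => i _; rewrite innerE big_ord1.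
rewrite [inner B B]inner_cols mulr_sumr; apply: ler_sum => j _.
have -> : col i (A *m B)^T j 0 = inner (col i A^T) (col j B).
  by rewrite innerE big_ord1 !mxE; apply: eq_bigr => k _; rewrite !mxE.
by rewrite -expr2 Cauchy_Schwarz_inner.
Qed.

Lemma frob0 m n : frob (0 : 'M[R]_(m, n)) = 0.
Proof. by rewrite /frob /inner mulmx0 mxtrace0 sqrtr0. Qed.

(** The Frobenius norm of [X] is an upper bound, which makes the [sup] in [spec_norm] a genuine
    least upper bound. *)
Lemma spec_norm_bounded m n (X : 'M[R]_(m, n)) :
  has_sup [set frob (X *m v) | v in [set v : 'cV[R]_n | frob v <= 1]].
Proof.
split; first by exists 0, 0; rewrite ?mulmx0 /= frob0.
exists (@frob R m n X) => _ [v /= v1 <-]; rewrite /frob ler_sqrt ?inner_ge0 //.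
apply: le_trans (inner_mulmx_le _ _) _; rewrite ler_piMr ?inner_ge0 //.
by move: v1; rewrite /frob -[X in _ <= X -> _]sqrtr1 ler_sqrt ?ltr01 ?ler01.
Qed.

Lemma spec_norm_ge0 m n (X : 'M[R]_(m, n)) : 0 <= spec_norm X.
Proof.
apply: sup_ubound; first by case: (spec_norm_bounded X).
by exists 0; rewrite ?mulmx0 /= frob0.
Qed.

Lemma spec_normP m n (X : 'M[R]_(m, n)) (v : 'cV_n) :
  inner (X *m v) (X *m v) <= spec_norm X ^+ 2 * inner v v.
Proof.
have [v0|v_neq0] := eqVneq (inner v v) 0.
  by rewrite (inner_eq0 v0) mulmx0 /inner !mulmx0 !mxtrace0 mulr0.
have v_gt0 : 0 < inner v v by rewrite lt_def v_neq0 inner_ge0.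
pose u := (Num.sqrt (inner v v))^-1 *: v.
have c2 : ((Num.sqrt (inner v v))^-1) ^+ 2 = (inner v v)^-1.
  by rewrite exprVn sqr_sqrtr ?inner_ge0.
have u1 : frob u <= 1.
  by rewrite /frob !inner_bilinear mulrA -expr2 c2 mulVf ?sqrtr1.
have : frob (X *m u) <= spec_norm X.
  by apply: sup_ubound; [case: (spec_norm_bounded X) | exists u].
rewrite /frob -(ler_pXn2r (n := 2)) ?nnegrE ?sqrtr_ge0 ?spec_norm_ge0 //.
rewrite sqr_sqrtr ?inner_ge0 // -scalemxAr !inner_bilinear mulrA -expr2 c2.
by rewrite mulrC ler_pdivrMr.
Qed.

(** With [B] a basis of the row space of [Z], take [B^T (B B^T)^-1 B]; the Gram matrix is invertible
    because [B] has full row rank. The factor [W] places the rows of [P] in the row space of [Z]. *)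
Lemma orthogonal_projection p n (Z : 'M[R]_(p, n)) : exists P : 'M[R]_n,
  [/\ P^T = P, P *m P = P, Z *m P = Z, exists W, P = W *m Z &
      \tr P = (\rank Z)%:R].
Proof.
have [B [B_free [C ZB] [W BZ]]] : exists B : 'M[R]_(\rank Z, n),
    [/\ row_free B, exists C, Z = C *m B & exists W, B = W *m Z].
  exists (row_base Z); split; first exact: row_base_free.
    by exists (col_base Z); rewrite mulmx_base.
  by apply/submxP; rewrite eq_row_base.
have BB : B *m B^T \in unitmx.
  by rewrite -row_free_unit /row_free mxrank_gram; exact: B_free.
pose K := invmx (B *m B^T).
have KT : K^T = K by rewrite /K trmx_inv trmx_mul trmxK.
have BP : B *m (B^T *m K *m B) = B by rewrite !mulmxA mulmxV // mul1mx.
exists (B^T *m K *m B); split.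
- by rewrite !trmx_mul trmxK KT mulmxA.
- by rewrite -[LHS]mulmxA BP.
- by rewrite {1}ZB -mulmxA BP -ZB.
- by exists (B^T *m K *m W); rewrite -[RHS]mulmxA -BZ.
- by rewrite -mulmxA mxtrace_mulC -mulmxA mulVmx ?mxtrace1.
Qed.

Lemma projectionC n (P : 'M[R]_n) : P^T = P -> P *m P = P ->
  (1%:M - P)^T = 1%:M - P /\ (1%:M - P) *m (1%:M - P) = 1%:M - P.
Proof.
move=> PT PP; rewrite [LHS]raddfB /= trmx1 PT; split=> //.
by rewrite mulmxBl mul1mx mulmxBr mulmx1 PP subrr subr0.
Qed.

Lemma inner_projr m n (A : 'M[R]_(m, n)) (P : 'M[R]_n) :
  P^T = P -> P *m P = P ->
  inner (A *m P) (A *m P) = inner A (A *m P).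
Proof. by move=> PT PP; rewrite inner_mulmxr PT -mulmxA PP. Qed.

Lemma inner_proj m n (A : 'M[R]_(m, n)) (P : 'M[R]_n) :
  P^T = P -> P *m P = P ->
  inner A A =
    inner (A *m P) (A *m P) + inner (A *m (1%:M - P)) (A *m (1%:M - P)).
Proof.
move=> PT PP; have [PcT PcPc] := projectionC PT PP.
by rewrite !inner_projr // mulmxBr mulmx1 innerDr innerNr addrC subrK.
Qed.

Lemma inner_proj2 n (P Q : 'M[R]_n) :
  P^T = P -> P *m P = P -> Q^T = Q -> Q *m Q = Q ->
  inner (Q *m P) (Q *m P) = \tr (Q *m P).
Proof.
by move=> PT PP QT QQ; rewrite inner_projr // /inner QT mulmxA QQ.
Qed.

Lemma Eckart_Young_orthogonal m n (X G Y : 'M[R]_(m, n)) (s c : R) :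
  0 <= s -> (\rank Y <= \rank X)%N -> G *m X^T = 0 -> X^T *m G = 0 ->
  (forall v : 'cV_n, inner (G *m v) (G *m v) <= s ^+ 2 * inner v v) ->
  (forall w : 'cV_m, c ^+ 2 * inner (X^T *m w) (X^T *m w)
     <= inner (X *m (X^T *m w)) (X *m (X^T *m w))) ->
  2 * c * inner G (Y - X) <= s * inner (Y - X) (Y - X).
Proof.
(* With P and Q the projections onto the row spaces of Y and X, comparing
   |s Y - M|^2, where M = s X + c G, with |M (1 - P)|^2 = |M|^2 - |M P|^2 reduces
   the claim to s^2 c^2 tr P <= s^2 c^2 tr Q; the overlap tr (Q P) cancels. *)
move=> s_ge0 rYX GX XG Gs Xc.
have [P [PT PP YP _ trP]] := orthogonal_projection Y.
have [Q [QT QQ XQ [W QW] trQ]] := orthogonal_projection X.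
have GQ : G *m Q = 0 by rewrite -QT QW trmx_mul mulmxA GX mul0mx.
have Gs_mx p (V : 'M[R]_(n, p)) : inner (G *m V) (G *m V) <= s ^+ 2 * inner V V.
  rewrite !inner_cols mulr_sumr ler_sum // => j _.
  by rewrite colE -mulmxA -colE.
have Xc_mx p (V : 'M[R]_(m, p)) : c ^+ 2 * inner (X^T *m V) (X^T *m V)
     <= inner (X *m (X^T *m V)) (X *m (X^T *m V)).
  rewrite !inner_cols mulr_sumr ler_sum // => j _.
  by rewrite !colE -!mulmxA -colE.
have [PcT PcPc] := projectionC PT PP; have [QcT QcQc] := projectionC QT QQ.
(* [G] vanishes on the row space of [X], so only the part [(1 - Q) P] of [P] counts, and its squared
   norm is [tr P - tr (Q P)]. *)
have GP : inner (G *m P) (G *m P) <= s ^+ 2 * (\tr P - \tr (Q *m P)).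
  have -> : G *m P = G *m ((1%:M - Q) *m P).
    by rewrite mulmxA mulmxBr mulmx1 GQ subr0.
  apply: le_trans (Gs_mx _ _) _; rewrite le_eqVlt; apply/orP; left; apply/eqP.
  by rewrite inner_proj2 // mulmxBl mul1mx raddfB.
(* [X] sees only the part [Q (1 - P)], which lies in the range of [X^T], where the lower bound [c]
   applies. *)
have XP : c ^+ 2 * (\tr Q - \tr (Q *m P)) <=
    inner (X *m (1%:M - P)) (X *m (1%:M - P)).
  have QE : Q *m (1%:M - P) = X^T *m (W^T *m (1%:M - P)).
    by rewrite -{1}QT QW trmx_mul mulmxA.
  have -> : X *m (1%:M - P) = X *m (Q *m (1%:M - P)) by rewrite mulmxA XQ.
  have -> : \tr Q - \tr (Q *m P) = inner (Q *m (1%:M - P)) (Q *m (1%:M - P)).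
    by rewrite inner_proj2 // mulmxBr mulmx1 raddfB.
  by rewrite QE.
have trPQ : \tr P <= \tr Q by rewrite trP trQ ler_nat.
have XG0 : inner X G = 0 by rewrite /inner XG mxtrace0.
have XGP : inner (X *m P) (G *m P) = 0.
  rewrite /inner trmx_mul mulmxA -[P^T *m _ *m G]mulmxA XG.
  by rewrite mulmx0 mul0mx mxtrace0.
pose M := s *: X + c *: G.
(* Since [Y P = Y], multiplying [s Y - M] by the projection [1 - P] removes [Y] and cannot increase
   the norm. *)
have MY : inner (M *m (1%:M - P)) (M *m (1%:M - P)) <=
    inner (s *: Y - M) (s *: Y - M).
  rewrite (inner_proj (s *: Y - M) PT PP).
  have -> : (s *: Y - M) *m (1%:M - P) = - (M *m (1%:M - P)).
    by rewrite mulmxBl -scalemxAl mulmxBr mulmx1 YP subrr scaler0 sub0r.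
  by rewrite !inner_bilinear opprK lerDr inner_ge0.
have MM : inner M M = s ^+ 2 * inner X X + c ^+ 2 * inner G G.
  by rewrite !inner_bilinear (innerC G X) XG0; ring.
have MPMP : inner (M *m P) (M *m P) =
    s ^+ 2 * inner (X *m P) (X *m P) + c ^+ 2 * inner (G *m P) (G *m P).
  rewrite mulmxDl -!scalemxAl !inner_bilinear (innerC (G *m P)) XGP; ring.
have YME : inner (s *: Y - M) (s *: Y - M) = s ^+ 2 * inner (Y - X) (Y - X)
    - 2 * s * c * inner G (Y - X) + c ^+ 2 * inner G G.
  have -> : s *: Y - M = s *: (Y - X) - c *: G.
    by rewrite scalerBr /M opprD addrA.
  move: (Y - X) => D; rewrite !inner_bilinear (innerC D G); ring.
have MD := inner_proj M PT PP.
have XD := congr1 ( *%R (s ^+ 2)) (inner_proj X PT PP).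
have s2_ge0 : 0 <= s ^+ 2 by rewrite sqr_ge0.
have c2_ge0 : 0 <= c ^+ 2 by rewrite sqr_ge0.
have GPc := ler_wpM2l c2_ge0 GP; have XPs := ler_wpM2l s2_ge0 XP.
have trPQs := ler_wpM2l (mulr_ge0 s2_ge0 c2_ge0) trPQ.
(* The comparison yields the claim multiplied by [s]. It can be divided out unless [s = 0], in which
   case [G = 0]. *)
have : 0 <= s * (s * inner (Y - X) (Y - X) - 2 * c * inner G (Y - X)) by lra.
have [s0 _|s_neq0] := eqVneq s 0; last first.
  by rewrite pmulr_rge0 ?lt_def ?s_neq0 // subr_ge0.
have G0 : inner G G = 0.
  apply/eqP; rewrite eq_le inner_ge0 andbT.
  by have := Gs_mx _ 1%:M; rewrite mulmx1 s0 expr0n mul0r.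
by rewrite (inner_eq0 G0) s0 /inner trmx0 mul0mx mxtrace0 mulr0 mul0r.
Qed.

End InnerTheory.

(** * Differentials of matrix functions *)

Section MatrixCalculus.
Variable R : realType.

Lemma mx_continuous (T : topologicalType) m n (F : T -> 'M[R]_(m, n)) :
  (forall i j, continuous (fun x => F x i j)) -> continuous F.
Proof.
move=> F_cont x A [P nP sPA]; rewrite /nbhs /=.
have : \forall y \near x, forall i j, P i j (F y i j).
  by apply: filter_forall => i; apply: filter_forall => j; exact: F_cont.
by apply: filterS => y Py; apply: sPA.
Qed.

Lemma mulmx_continuous m n p :
  continuous (fun AB : 'M[R]_(m, n) * 'M[R]_(n, p) => AB.1 *m AB.2).
Proof.
apply: mx_continuous => i j.
rewrite (_ : (fun _ => _) = \sum_k (fun AB : 'M[R]_(m, n) * 'M[R]_(n, p) =>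
  AB.1 i k * AB.2 k j)); last first.
  by apply/funext => AB; rewrite mxE fct_sumE.
apply: (big_ind (fun F => continuous F)) => [AB|F G Fc Gc AB|k _ AB].
- exact: cvg_cst.
- by apply: continuousD; [exact: Fc | exact: Gc].
by apply: continuousM;
  apply: (continuous_comp _ (@coord_continuous _ _ _ _ _ _));
  [exact: cvg_fst | exact: cvg_snd].
Qed.

Lemma trmx_continuous m n : continuous (@trmx R m n).
Proof.
apply: mx_continuous => i j.
rewrite (_ : (fun _ => _) = fun A : 'M[R]_(m, n) => A j i).
  exact: coord_continuous.
by apply/funext => A; rewrite mxE.
Qed.

Lemma is_diff_mulmx (V : normedModType R) m n p (F dF : V -> 'M[R]_(m, n))
    (G dG : V -> 'M[R]_(n, p)) x :
  is_diff x F dF -> is_diff x G dG ->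
  is_diff x (fun y => F y *m G y) (fun h => F x *m dG h + dF h *m G x).
Proof.
move=> Fx Gx.
have mul_diff : is_diff (F x, G x)
    (fun AB : 'M[R]_(m, n) * 'M[R]_(n, p) => AB.1 *m AB.2)
    (fun H => F x *m H.2 + H.1 *m G x).
  apply: DiffDef.
    apply: (@differentiable_bilin _ _ _ _ (@mulmx R m n p)).
    exact: mulmx_continuous.
  by rewrite (@diff_bilin _ _ _ _ (@mulmx R m n p)) //; exact: mulmx_continuous.
exact: is_diff_comp (is_diff_pair Fx Gx) mul_diff.
Qed.

Lemma is_diff_trmx (V : normedModType R) m n (F dF : V -> 'M[R]_(m, n)) x :
  is_diff x F dF -> is_diff x (fun y => (F y)^T) (fun h => (dF h)^T).
Proof.
move=> Fx; have tr_diff : is_diff (F x) (@trmx R m n) (@trmx R m n).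
  apply: DiffDef.
    apply: (@linear_differentiable _ _ _ (@trmx R m n)).
    exact: trmx_continuous.
  by apply: (@diff_lin _ _ _ (@trmx R m n)); exact: trmx_continuous.
exact: is_diff_comp Fx tr_diff.
Qed.

(** A differential is linear, hence determined by its values on the matrices [delta_mx i j]. This
    lets gradients be read off from the chain and product rules. *)
Lemma gradP m n (f : 'M[R]_(m, n) -> R) X G :
  is_diff X f (inner G) <-> differentiable f X /\ grad f X = G.
Proof.
split=> [fX|[fX <-]].
  have f_diff : differentiable f X by exact: ex_diff.
  split=> //; apply/matrixP => i j; rewrite mxE deriveE // diff_val.
  exact: inner_delta.
apply: DiffDef => //; apply/funext => H; rewrite [in LHS](matrix_sum_delta H).
rewrite linear_sum innerE exchange_big /=; apply: eq_bigr => i _.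
rewrite linear_sum; apply: eq_bigr => j _.
by rewrite linearZ /= mxE deriveE // mulrC.
Qed.

Lemma is_diff_fst (V W : normedModType R) (p : V * W) : is_diff p fst fst.
Proof.
have fst_cont : continuous (@fst V W) by move=> ?; exact: cvg_fst.
by apply: DiffDef; [exact: linear_differentiable | exact: diff_lin].
Qed.

Lemma is_diff_snd (V W : normedModType R) (p : V * W) : is_diff p snd snd.
Proof.
have snd_cont : continuous (@snd V W) by move=> ?; exact: cvg_snd.
by apply: DiffDef; [exact: linear_differentiable | exact: diff_lin].
Qed.

End MatrixCalculus.

(** * Stationary points *)

Section Stationarity.
Variable R : realType.

(* G annihilates the tangent cone at X of the matrices of rank at most r; below
   rank r this cone spans all matrices. *)
Definition stationary m n r (X G : 'M[R]_(m, n)) :=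
  [/\ G *m X^T = 0, X^T *m G = 0 & (\rank X < r)%N -> G = 0].

(** The directions [G X^T X] and [X X^T G] keep the rank of [X + t D] at most that of [X], and
    pairing them with [G] gives the squared norms of [G X^T] and [X^T G]. Below rank r every
    elementary matrix is an admissible direction. *)
Lemma stationary_of_lines m n r (X G : 'M[R]_(m, n)) : (\rank X <= r)%N ->
  (forall D, (forall t, (\rank (X + t *: D)%R <= r)%N) -> inner G D = 0) ->
  stationary r X G.
Proof.
move=> Xr G0; split.
- apply: inner_eq0; rewrite inner_mulmxr trmxK; apply: G0 => t.
  have -> : X + t *: (G *m X^T *m X) = (1%:M + t *: (G *m X^T)) *m X.
    by rewrite mulmxDl mul1mx scalemxAl.
  exact: leq_trans (mxrankM_maxr _ _) Xr.
- apply: inner_eq0; rewrite inner_mulmxl trmxK; apply: G0 => t.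
  have -> : X + t *: (X *m (X^T *m G)) = X *m (1%:M + t *: (X^T *m G)).
    by rewrite mulmxDr mulmx1 scalemxAr.
  exact: leq_trans (mxrankM_maxl _ _) Xr.
- move=> X_lt_r; apply/matrixP => i j; rewrite mxE -inner_delta; apply: G0 => t.
  apply: leq_trans (mxrank_add _ _) _.
  apply: leq_trans (leq_add (leqnn _) (mxrank_scale _ _)) _.
  by rewrite mxrank_delta addn1.
Qed.

Lemma quadratic_ge0 (a b : R) : (forall t, 0 <= a * t ^+ 2 + b * t) -> b = 0.
Proof.
move=> ge0; have a1 : 0 < `|a| + 1 by rewrite ltr_wpDl.
(* The denominator is positive and exceeds [a], so for any sign of [a] the value at this point is
   negative unless [b = 0]. *)
have := ge0 (- b / (`|a| + 1)).
have -> : a * (- b / (`|a| + 1)) ^+ 2 + b * (- b / (`|a| + 1)) =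
    - ((`|a| - a + 1) * (b / (`|a| + 1)) ^+ 2) by field; rewrite gt_eqF.
rewrite oppr_ge0 pmulr_rle0; last by rewrite ltr_wpDl // subr_ge0 ler_norm.
move=> b0; have : (b / (`|a| + 1)) ^+ 2 == 0 by rewrite eq_le b0 sqr_ge0.
by rewrite expf_eq0 /= mulf_eq0 invr_eq0 (gt_eqF a1) orbF => /eqP.
Qed.

(** Along an admissible line the squared distance to [X - eta G] is a quadratic in [t], minimal at
    0, with linear coefficient [2 eta <G, D>]. *)
Lemma pgd_fixed_stationary m n r (f : 'M[R]_(m, n) -> R) eta X : 0 < eta ->
  pgd_fixed r f eta X -> stationary r X (grad f X).
Proof.
move=> eta_gt0 [Xr Xmin]; apply: stationary_of_lines => // D Dr.
move: Xmin; move: (grad f X) => G Xmin.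
suff : 2 * eta * inner G D = 0.
  by move/eqP; rewrite !mulf_eq0 pnatr_eq0 (gt_eqF eta_gt0) => /eqP.
apply: (quadratic_ge0 (a := inner D D)) => t.
have := Xmin _ (Dr t); rewrite /frob ler_sqrt ?inner_ge0 //.
have -> : X - (X - eta *: G) = eta *: G by rewrite opprB addrC subrK.
have -> : X + t *: D - (X - eta *: G) = t *: D + eta *: G.
  by rewrite opprB [X + _]addrC addrACA subrr addr0.
rewrite !inner_bilinear (innerC D G); lra.
Qed.

Lemma is_diff_line (V : normedModType R) (X D : V) (t : R) :
  is_diff t (fun s => X + s *: D) (fun s => s *: D).
Proof.
have cst_diff : is_diff t (fun=> X) (fun=> 0 : V) by exact: is_diff_cst.
have scale_diff : is_diff t ( *:%R ^~ D) ( *:%R ^~ D) by exact: is_diff_scalel.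
apply: is_diff_eq (is_diffD cst_diff scale_diff) _.
by apply/funext => s /=; rewrite add0r.
Qed.

(** An admissible line stays feasible, so [f] along it is minimal at [t = 0], where its derivative
    is [<grad f X, D>]. *)
Lemma rank_global_min_stationary m n r (f : 'M[R]_(m, n) -> R) X :
  (forall Y, differentiable f Y) -> rank_global_min r f X ->
  stationary r X (grad f X).
Proof.
move=> f_diff [Xr Xmin]; apply: stationary_of_lines => // D Dr.
pose h t := f (X + t *: D).
have h_diff t : is_diff t h (fun s => inner (grad f (X + t *: D)) (s *: D)).
  have fx : is_diff (X + t *: D) f (inner (grad f (X + t *: D))) by apply/gradP.
  exact: is_diff_comp (is_diff_line X D t) fx.
have h_min : is_derive (0 : R) (1 : R) h (0 : R).
  apply: (@derive1_at_min _ _ (-1) 1) => [|t _||t _].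
  - by lra.
  - by apply/derivable1_diffP; exact: ex_diff.
  - by rewrite in_itv /= ltrN10 ltr01.
  - by rewrite /h scale0r addr0; exact: Xmin (Dr t).
have := @derive_val _ _ _ _ _ _ _ h_min.
rewrite deriveE ?diff_val; last exact: ex_diff.
by rewrite /= scale0r addr0 scale1r.
Qed.

Lemma grad_pair_factored m n r (f : 'M[R]_(m, n) -> R)
    (p : 'M[R]_(m, r) * 'M[R]_(n, r)) :
  (forall Y, differentiable f Y) ->
  grad_pair (factored (r := r) f) p =
  (grad f (p.1 *m p.2^T) *m p.2, (grad f (p.1 *m p.2^T))^T *m p.1).
Proof.
case: p => A B f_diff; rewrite /grad_pair /factored /=.
have fX : is_diff (A *m B^T) f (inner (grad f (A *m B^T))) by apply/gradP.
congr (_, _).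
- apply: (proj2 (proj1 (gradP _ _ _) _)).
  have AB := is_diff_mulmx (is_diff_id A) (is_diff_cst B^T A).
  apply: is_diff_eq (is_diff_comp AB fX) _; apply/funext => H /=.
  by rewrite mulmx0 add0r inner_mulmxr.
- apply: (proj2 (proj1 (gradP _ _ _) _)).
  have AB := is_diff_mulmx (is_diff_cst A B) (is_diff_trmx (is_diff_id B)).
  apply: is_diff_eq (is_diff_comp AB fX) _; apply/funext => H /=.
  rewrite mul0mx addr0 innerC inner_mulmxl.
  by rewrite -(inner_trmx H^T) trmx_mul !trmxK innerC.
Qed.

(** [E] is the derivative of [A B^T] in the direction [(H, K)]. The product rule gives two cross
    terms, both equal to [<H, G K>], and the curvature of [f] along [E]. *)
Lemma sosp_hessian m n r (f : 'M[R]_(m, n) -> R)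
    (A : 'M[R]_(m, r)) (B : 'M[R]_(n, r)) :
  twice_differentiable f -> sosp (factored (r := r) f) (A, B) ->
  forall H K E, E = A *m K^T + H *m B^T ->
  0 <= 2 * inner H (grad f (A *m B^T) *m K)
       + inner E ('d (grad f) (A *m B^T) E).
Proof.
move=> [f_diff gf_diff] [_ hess] H K E EE.
pose G := grad f (A *m B^T); pose dG := 'd (grad f) (A *m B^T).
pose p := (A, B).
have fst_p := is_diff_fst p; have snd_p := is_diff_snd p.
have AB := is_diff_mulmx fst_p (is_diff_trmx snd_p).
have Gx : is_diff (A *m B^T) (grad f) dG by apply: DiffDef.
have GAB := is_diff_comp AB Gx.
have := is_diff_pair (is_diff_mulmx GAB snd_p)
  (is_diff_mulmx (is_diff_trmx GAB) fst_p).
have -> : (fun y => ((grad f \o (fun y0 => y0.1 *m y0.2^T)) y *m y.2,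
    ((grad f \o (fun y0 => y0.1 *m y0.2^T)) y)^T *m y.1)) =
    grad_pair (factored (r := r) f).
  by apply/funext => q; rewrite grad_pair_factored.
move=> grad_diff; have := hess (H, K); rewrite diff_val /inner_pair /=.
rewrite -/G -/dG -EE !innerDr.
move: (dG E) => L.
have -> : inner H (L *m B) = inner (H *m B^T) L by rewrite inner_mulmxr trmxK.
have -> : inner K (G^T *m H) = inner H (G *m K) by rewrite -inner_mulmxl innerC.
have -> : inner K (L^T *m A) = inner (A *m K^T) L.
  by rewrite -inner_mulmxl innerC inner_mulmxr trmxK.
rewrite EE innerDl; lra.
Qed.

(** The vanishing gradient says [G B = 0] and [G^T A = 0], which gives the two orthogonality
    relations. Below rank r a factor has a kernel vector, and the Hessian along directions built
    from it forces [G = 0]. *)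
Lemma sosp_stationary m n r (f : 'M[R]_(m, n) -> R)
    (A : 'M[R]_(m, r)) (B : 'M[R]_(n, r)) :
  twice_differentiable f -> sosp (factored (r := r) f) (A, B) ->
  stationary r (A *m B^T) (grad f (A *m B^T)).
Proof.
move=> f2 fAB; have hess := sosp_hessian f2 fAB.
have [f_diff _] := f2; have [grad0 _] := fAB.
move: grad0; rewrite grad_pair_factored //=; move: hess.
set dG := 'd (grad f) _; move: (grad f _) => G hess [GB GTA].
have AG : A^T *m G = 0 by apply: trmx_inj; rewrite trmx_mul trmxK GTA trmx0.
split.
- by rewrite trmx_mul trmxK mulmxA GB mul0mx.
- by rewrite trmx_mul trmxK -mulmxA AG mulmx0.
move=> AB_lt_r.
(* Scaling the factor which is not annihilated makes the curvature term
   quadratic in t, so that the linear cross term vanishes. *)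
have GHK H K : A *m K^T = 0 \/ H *m B^T = 0 -> inner H (G *m K) = 0.
  move=> AK_HB; suff : 2 * inner H (G *m K) = 0.
    by move/eqP; rewrite mulf_eq0 pnatr_eq0 => /eqP.
  case: AK_HB => [AK|HB].
    apply: (quadratic_ge0 (a := inner (H *m B^T) (dG (H *m B^T)))) => t.
    have := hess (t *: H) K _ erefl.
    rewrite AK add0r -scalemxAl linearZ /= !inner_bilinear; lra.
  apply: (quadratic_ge0 (a := inner (A *m K^T) (dG (A *m K^T)))) => t.
  have := hess H (t *: K) _ erefl.
  rewrite HB addr0 !linearZ /= !inner_bilinear; lra.
(* If [A] has full column rank, then [A B^T] has the rank of [B], so one of the two factors must
   have rank below r. *)
have [u u_neq0 u_ker] :
    exists2 u : 'rV[R]_r, u != 0 & A *m u^T = 0 \/ u *m B^T = 0.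
  have ker k (C : 'M[R]_(k, r)) : (\rank C < r)%N ->
      exists2 u : 'rV[R]_r, u != 0 & u *m C^T = 0.
    move=> C_lt_r; exists (nz_row (kermx C^T)).
      by rewrite nz_row_eq0 -mxrank_eq0 mxrank_ker mxrank_tr subn_eq0 -ltnNge.
    by apply/sub_kermxP; exact: nz_row_sub.
  have [A_lt_r|r_le_A] := ltnP (\rank A) r.
    have [u u_neq0 uA] := ker _ A A_lt_r; exists u => //; left.
    by apply: trmx_inj; rewrite trmx_mul trmxK uA trmx0.
  have [|u u_neq0 uB] := ker _ B; last by exists u => //; right.
  have A_free : row_free A^T.
    by rewrite /row_free mxrank_tr eqn_leq rank_leq_col.
  by move: AB_lt_r; rewrite -mxrank_tr trmx_mul trmxK mxrankMfree.
have uu : inner u u != 0 by apply: contra_neq u_neq0 => /inner_eq0.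
apply/matrixP => i j; rewrite mxE.
(* These rank-one directions isolate one entry: [<H, G K> = |u|^2 G i j], while [A K^T] or [H B^T]
   vanishes according to which factor [u] annihilates. *)
pose H := delta_mx i 0 *m u; pose K := delta_mx j 0 *m u.
have : inner H (G *m K) = 0.
  apply: GHK; case: u_ker => [Au|uB]; [left | right].
    by rewrite trmx_mul mulmxA Au mul0mx.
  by rewrite -mulmxA uB mulmx0.
have -> : inner H (G *m K) = inner u u * G i j.
  rewrite inner_mulmxr !mulmxA -mulmxA [u *m _]mx11_scalar mul_mx_scalar.
  rewrite innerZr.
  rewrite innerC inner_delta -colE [col j G _ _]mxE.
  by rewrite /inner mxtrace_mulC /mxtrace big_ord1.
by move/eqP; rewrite mulf_eq0 (negPf uu) => /eqP.
Qed.

(* The constant k of the header. *)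
Definition concavity m n r (X G : 'M[R]_(m, n)) : R :=
  if (\rank X < r)%N then 0 else spec_norm G / sigma r X.

Lemma stationary_inner_le m n r (X G Y : 'M[R]_(m, n)) :
  (0 < r)%N -> (\rank X <= r)%N -> stationary r X G -> (\rank Y <= r)%N ->
  - inner G (Y - X) <= concavity r X G / 2 * frob (Y - X) ^+ 2.
Proof.
move=> r_gt0 X_le_r [GX XG G0] Y_le_r.
rewrite /concavity /frob sqr_sqrtr ?inner_ge0 //.
case: ltnP => [X_lt_r|r_le_X].
  by rewrite (G0 X_lt_r) /inner trmx0 mul0mx mxtrace0 oppr0 !mul0r.
have rE : \rank X = r by apply/eqP; rewrite eqn_leq X_le_r.
have [|sigma_gt0 Xsigma] := @sigma_rank _ _ _ X; first by rewrite rE.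
rewrite rE in sigma_gt0 Xsigma.
(* Eckart-Young is applied to [- G], with [s] the spectral norm of [G] and [c] the smallest nonzero
   singular value of [X]. *)
have : 2 * sigma r X * inner (- G) (Y - X) <=
    spec_norm G * inner (Y - X) (Y - X).
  apply: Eckart_Young_orthogonal => //;
    rewrite ?spec_norm_ge0 ?rE ?mulNmx ?mulmxN ?GX ?XG ?oppr0 //.
  by move=> v; rewrite mulNmx !inner_bilinear opprK; exact: spec_normP.
rewrite innerNl; move: (inner G _) (inner (Y - X) _) => a b h.
have -> : spec_norm G / sigma r X / 2 * b = spec_norm G * b / (2 * sigma r X).
  by field; rewrite gt_eqF.
by rewrite ler_pdivlMr ?mulr_gt0 // mulrC.
Qed.

End Stationarity.

(** * Uniqueness of stationary points in the region *)

Theorem theorem3 (R : realType) (m n r : nat)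
    (m_gt0 : (0 < m)%N) (n_gt0 : (0 < n)%N) (r_gt0 : (0 < r)%N)
    (r_le : (r <= minn m n)%N)
    (f : 'M[R]_(m, n) -> R) (f_diff2 : twice_differentiable f)
    (alpha : R) (alpha_gt0 : 0 < alpha)
    (XX : set 'M[R]_(m, n))
    (XX_rank : XX `<=` [set X | (\rank X <= r)%N])
    (f_rsc : rsc alpha XX f)
    (Xhat : 'M[R]_(m, n))
    (Xhat_min : rank_global_min r f Xhat)
    (Xhat_XX : XX Xhat)
    (Xhat_cond : (\rank Xhat < r)%N \/
       (\rank Xhat = r /\ spec_norm (grad f Xhat) < alpha * sigma r Xhat)) :
  (forall (eta : R) (X : 'M[R]_(m, n)), 0 < eta ->
     pgd_fixed r f eta X -> uniq_region r f alpha XX Xhat X -> X = Xhat) /\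
  (forall (A : 'M[R]_(m, r)) (B : 'M[R]_(n, r)),
     sosp (factored (r := r) f) (A, B) ->
     uniq_region r f alpha XX Xhat (A *m B^T) -> A *m B^T = Xhat).
Proof.
(* Fixed points of PGD and second-order stationary points enter only through first-order
   stationarity on the low-rank matrices. *)
suff main X : stationary r X (grad f X) ->
    uniq_region r f alpha XX Xhat X -> X = Xhat.
  split=> [eta X eta_gt0 X_fixed|A B AB_sosp]; apply: main.
    exact: pgd_fixed_stationary X_fixed.
  exact: sosp_stationary.
move=> X_stat X_region.
have [f_diff _] := f_diff2.
have Xhat_stat := rank_global_min_stationary f_diff Xhat_min.
have Xhat_r : (\rank Xhat <= r)%N := XX_rank _ Xhat_XX.
have XXX : XX X by move: X_region; rewrite /uniq_region; case: ifP => _ [].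
have X_r : (\rank X <= r)%N := XX_rank _ XXX.
have k_lt :
    concavity r X (grad f X) + concavity r Xhat (grad f Xhat) < 2 * alpha.
  (* When [Xhat] has rank r, its assumed gradient bound covers the case of an [X] of smaller rank,
     whose own constant is 0. *)
  have khat_lt : (\rank Xhat < r)%N = false ->
      spec_norm (grad f Xhat) / sigma r Xhat < alpha.
    move=> Xhat_ge; case: Xhat_cond => [|[Xhat_rank spec_lt]].
      by rewrite Xhat_ge.
    have := sigma_rank (X := Xhat).
    rewrite Xhat_rank => /(_ r_gt0)[sigma_gt0 _].
    by rewrite ltr_pdivrMr.
  have alpha_lt : alpha < 2 * alpha by rewrite mulr_natl mulr2n ltrDl.
  move: X_region khat_lt; rewrite /uniq_region /concavity.
  have [Xhat_lt|Xhat_ge] := boolP (\rank Xhat < r)%N => -[_ X_lt] khat_lt.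
    rewrite addr0; case: X_lt => [->|k_lt]; first by rewrite mulr_gt0.
    by case: ifP => _; [rewrite mulr_gt0 | exact: k_lt].
  have {}khat_lt := lt_trans (khat_lt erefl) alpha_lt.
  case: X_lt => [->|k_lt]; first by rewrite add0r; exact: khat_lt.
  case: ifP => _; first by rewrite add0r; exact: khat_lt.
  by rewrite addrC; exact: k_lt.
move: (stationary_inner_le r_gt0 X_r X_stat Xhat_r)
  (stationary_inner_le r_gt0 Xhat_r Xhat_stat X_r)
  (f_rsc _ _ XXX Xhat_XX) (f_rsc _ _ Xhat_XX XXX) k_lt.
move: (concavity r X (grad f X)) => k.
move: (concavity r Xhat (grad f Xhat)) => khat.
have frobC (Y Z : 'M[R]_(m, n)) : frob (Y - Z) = frob (Z - Y).
  by rewrite -opprB /frob innerNl innerNr opprK.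
rewrite (frobC Xhat X); move Ed : (frob (X - Xhat)) => d.
move: (inner (grad f X) (Xhat - X)) (inner (grad f Xhat) (X - Xhat)) => a b.
move: (f X) (f Xhat) => fX fXhat.
move=> h1 h2 h3 h4 k_lt; have : (2 * alpha - (k + khat)) * d ^+ 2 <= 0 by lra.
rewrite pmulr_rle0 ?subr_gt0 // -Ed => d0.
have : inner (X - Xhat) (X - Xhat) = 0.
  by apply/eqP; rewrite eq_le inner_ge0 andbT -[leLHS]sqr_sqrtr ?inner_ge0.
by move/inner_eq0/eqP; rewrite subr_eq0 => /eqP.
Qed.
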